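(* Let $D$ be an integral domain and let $x,y,z$ be indeterminates over $D$. Then for every ring $B$ with $D[x,y]\subseteq B\subseteq D[[x,y]]$, the extension $B[[z]]\hookrightarrow B_x[[z]]$ is not a TGF extension.
   Context: For a domain $B$ and $0\neq x\in B$, $B_x$ denotes the fraction ring $B[1/x]$. An extension $R\subseteq S$ of integral domains is called a trivial generic fiber (TGF) extension if every nonzero prime ideal of $S$ has nonzero intersection with $R$. *)

(* Defs.v *)
(* MathComp, with the classical axioms of [boolp]: membership in a subset and
   invertibility are booleans by excluded middle. *)
From HB Require Import structures.
From mathcomp Require Import all_boot all_order all_algebra.
From mathcomp Require Import boolp.

Set Implicit Arguments.
Unset Strict Implicit.
Unset Printing Implicit Defensive.

Import GRing.Theory.
Local Open Scope ring_scope.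

Local Notation "a %:F" := (tofrac a).

Section ClassicalInverse.
Variable R : comNzRingType.

Definition cunit : pred R := fun a => `[< exists b, b * a = 1 >].

Definition cinv (a : R) : R :=
  if pselect (exists b, b * a = 1) is left e then projT1 (cid e) else a.

Lemma cmulVx : {in cunit, left_inverse 1 cinv *%R}.
Proof.
move=> a /asboolP ua; rewrite /cinv.
by case: pselect => // e; case: cid.
Qed.

Lemma cunitPl (a b : R) : b * a = 1 -> cunit a.
Proof. by move=> ba; apply/asboolP; exists b. Qed.

Lemma cinv_out : {in [predC cunit], cinv =1 id}.
Proof.
move=> a /negP na; rewrite /cinv; case: pselect => // e.
by case: na; apply/asboolP.
Qed.
End ClassicalInverse.

(* A type distinct from [nat -> R], on which the classical library already puts
   the pointwise ring structure. *)
Record fps (R : Type) := Fps { fps_coef : nat -> R }.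

Notation "{ 'fps' R }" := (fps R) (format "{ 'fps'  R }").
Notation "f `[ n ]" := (fps_coef f n)
  (at level 2, left associativity, format "f `[ n ]").

HB.instance Definition _ (R : Type) := [isNew for @fps_coef R].
HB.instance Definition _ (R : choiceType) := [Choice of {fps R} by <:].

Lemma fpsP (R : Type) (f g : {fps R}) : (forall n, f`[n] = g`[n]) <-> f = g.
Proof. by split=> [fg|-> //]; apply: val_inj; apply: funext. Qed.

Section FpsZmod.
Variable R : zmodType.

Definition fps_zero : {fps R} := Fps (fun=> 0).
Definition fps_opp (f : {fps R}) : {fps R} := Fps (fun n => - f`[n]).
Definition fps_add (f g : {fps R}) : {fps R} := Fps (fun n => f`[n] + g`[n]).

Fact fps_addA : associative fps_add.
Proof. by move=> f g h; apply/fpsP => n /=; rewrite addrA. Qed.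
Fact fps_addC : commutative fps_add.
Proof. by move=> f g; apply/fpsP => n /=; rewrite addrC. Qed.
Fact fps_add0 : left_id fps_zero fps_add.
Proof. by move=> f; apply/fpsP => n /=; rewrite add0r. Qed.
Fact fps_addN : left_inverse fps_zero fps_opp fps_add.
Proof. by move=> f; apply/fpsP => n /=; rewrite addNr. Qed.

HB.instance Definition _ := GRing.isZmodule.Build {fps R}
  fps_addA fps_addC fps_add0 fps_addN.

Lemma fps_coef0 n : (0 : {fps R})`[n] = 0. Proof. by []. Qed.
Lemma fps_coefD (f g : {fps R}) n : (f + g)`[n] = f`[n] + g`[n].
Proof. by []. Qed.
Lemma fps_coefN (f : {fps R}) n : (- f)`[n] = - f`[n]. Proof. by []. Qed.

Lemma fps_coef_sum I (r : seq I) (P : pred I) (F : I -> {fps R}) n :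
  (\sum_(i <- r | P i) F i)`[n] = \sum_(i <- r | P i) (F i)`[n].
Proof. by elim/big_rec2: _ => // i _ f _ <-. Qed.
End FpsZmod.

Section FpsRing.
Variable R : nzRingType.

Definition fps_one : {fps R} := Fps (fun n => (n == 0)%:R).
Definition fps_mul (f g : {fps R}) : {fps R} :=
  Fps (fun n => \sum_(i < n.+1) f`[i] * g`[n - i]).

Definition fps_trunc m (f : {fps R}) : {poly R} := \poly_(i < m.+1) f`[i].

Lemma fps_coef_trunc m (f : {fps R}) n : (n <= m)%N -> (fps_trunc m f)`_n = f`[n].
Proof. by move=> nm; rewrite coef_poly ltnS nm. Qed.

Lemma fps_mul_trunc m (f g : {fps R}) n : (n <= m)%N ->
  (fps_mul f g)`[n] = (fps_trunc m f * fps_trunc m g)`_n.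
Proof.
move=> nm; rewrite coefM; apply: eq_bigr => i _.
by rewrite !fps_coef_trunc // (leq_trans _ nm) ?leq_subr // -ltnS.
Qed.

Fact fps_mulA : associative fps_mul.
Proof.
move=> f g h; apply/fpsP => n; transitivity
  (fps_trunc n f * fps_trunc n g * fps_trunc n h)`_n.
  rewrite -mulrA coefM; apply: eq_bigr => i _.
  by rewrite fps_coef_trunc -1?ltnS // -fps_mul_trunc ?leq_subr.
rewrite coefM; apply: eq_bigr => i _.
by rewrite fps_coef_trunc ?leq_subr // -fps_mul_trunc // -ltnS.
Qed.

Lemma fps_coef_trunc1 n : fps_trunc n fps_one = 1.
Proof.
apply/polyP => i; rewrite coef_poly coef1 /=.
by case: ltnP => //; case: i.
Qed.

Fact fps_mul1 : left_id fps_one fps_mul.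
Proof.
move=> f; apply/fpsP => n; rewrite (fps_mul_trunc _ _ (leqnn n)).
by rewrite fps_coef_trunc1 mul1r fps_coef_trunc.
Qed.
Fact fps_mulr1 : right_id fps_one fps_mul.
Proof.
move=> f; apply/fpsP => n; rewrite (fps_mul_trunc _ _ (leqnn n)).
by rewrite fps_coef_trunc1 mulr1 fps_coef_trunc.
Qed.
Fact fps_mulDl : left_distributive fps_mul +%R.
Proof.
move=> f g h; apply/fpsP => n; rewrite /= -big_split /=.
by apply: eq_bigr => i _; rewrite mulrDl.
Qed.
Fact fps_mulDr : right_distributive fps_mul +%R.
Proof.
move=> f g h; apply/fpsP => n; rewrite /= -big_split /=.
by apply: eq_bigr => i _; rewrite mulrDr.
Qed.
Fact fps_one_neq0 : fps_one != 0.
Proof. by apply/eqP => /fpsP/(_ 0)/eqP; rewrite /= oner_eq0. Qed.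

HB.instance Definition _ := GRing.Zmodule_isNzRing.Build {fps R}
  fps_mulA fps_mul1 fps_mulr1 fps_mulDl fps_mulDr fps_one_neq0.

Lemma fps_coef1 n : (1 : {fps R})`[n] = (n == 0)%:R. Proof. by []. Qed.
Lemma fps_coefM (f g : {fps R}) n :
  (f * g)`[n] = \sum_(i < n.+1) f`[i] * g`[n - i].
Proof. by []. Qed.
End FpsRing.

Section FpsComRing.
Variable R : comNzRingType.

Fact fps_mulC : commutative (@GRing.mul {fps R}).
Proof.
by move=> f g; apply/fpsP => n; rewrite !(fps_mul_trunc _ _ (leqnn n)) mulrC.
Qed.

HB.instance Definition _ := GRing.PzRing_hasCommutativeMul.Build {fps R} fps_mulC.
HB.instance Definition _ := GRing.ComNzRing_hasMulInverse.Build {fps R}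
  (@cmulVx {fps R}) (@cunitPl {fps R}) (@cinv_out {fps R}).
End FpsComRing.

Section FpsIdomain.
Variable R : idomainType.

Lemma fps_order (f : {fps R}) : f != 0 ->
  exists2 m, f`[m] != 0 & forall i, (i < m)%N -> f`[i] = 0.
Proof.
move=> f0; have ex : exists n, f`[n] != 0.
  apply: contrapT => nex; case/eqP: f0; apply/fpsP => n.
  by apply/eqP; apply/negPn/negP => fn; apply: nex; exists n.
case: (ex_minnP ex) => m fm min_m; exists m => // i.
by rewrite ltnNge => im; apply/eqP; apply/negPn; apply: contra im => /min_m.
Qed.

Fact fps_idomain : GRing.integral_domain_axiom {fps R}.
Proof.
move=> f g fg0; apply/norP => -[/fps_order[m fm lem] /fps_order[k gk lek]].
move/fpsP/(_ (m + k)%N)/eqP: fg0; apply/negP; rewrite fps_coefM fps_coef0.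
have mmk : (m < (m + k).+1)%N by rewrite ltnS leq_addr.
rewrite (bigD1 (Ordinal mmk)) //= addKn big1 ?addr0 ?mulf_neq0 // => i.
rewrite -val_eqE /= => im; case: (ltngtP i m) im => // im _.
  by rewrite lem ?mul0r.
by rewrite lek ?mulr0 // ltn_subLR ?ltn_add2r // -ltnS.
Qed.

HB.instance Definition _ :=
  GRing.ComUnitRing_isIntegral.Build {fps R} fps_idomain.
End FpsIdomain.

Section FpsMap.
Variables (R S : nzRingType) (h : {rmorphism R -> S}).

Definition fps_map (f : {fps R}) : {fps S} := Fps (fun n => h f`[n]).

Fact fps_map_zmod : zmod_morphism fps_map.
Proof. by move=> f g; apply/fpsP => n /=; rewrite rmorphB. Qed.
Fact fps_map_monoid : monoid_morphism fps_map.
Proof.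
split=> [|f g]; apply/fpsP => n /=; first by rewrite rmorph_nat.
by rewrite rmorph_sum; apply: eq_bigr => i _; rewrite rmorphM.
Qed.

HB.instance Definition _ :=
  GRing.isZmodMorphism.Build {fps R} {fps S} fps_map fps_map_zmod.
HB.instance Definition _ :=
  GRing.isMonoidMorphism.Build {fps R} {fps S} fps_map fps_map_monoid.

Lemma fps_map_inj : injective h -> injective fps_map.
Proof. by move=> hI f g /fpsP fg; apply/fpsP => n; apply/hI/fg. Qed.
End FpsMap.

(* D[[x,y]] is {fps {fps D}} = D[[x]][[y]], and, as in [polyXY], D[x,y] is
   {poly {poly D}} = D[x][y]: in both cases x is the inner indeterminate and y
   the outer one, so that f`[j]`[i] is the coefficient of x^i y^j. *)
Definition fps_of_poly2 (R : nzRingType) (p : {poly {poly R}}) :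
  {fps {fps R}} := Fps (fun j => Fps (fun i => p`_j`_i)).

Lemma fps2_coefM (R : nzRingType) (f g : {fps {fps R}}) j i :
  (f * g)`[j]`[i] =
    \sum_(b < j.+1) \sum_(a < i.+1) f`[b]`[a] * g`[j - b]`[i - a].
Proof. by rewrite fps_coefM fps_coef_sum. Qed.

Fact fps_of_poly2_zmod (R : nzRingType) : zmod_morphism (@fps_of_poly2 R).
Proof. by move=> p q; apply/fpsP => j; apply/fpsP => i /=; rewrite !coefB. Qed.

Fact fps_of_poly2_monoid (R : nzRingType) : monoid_morphism (@fps_of_poly2 R).
Proof.
split=> [|p q]; apply/fpsP => j; apply/fpsP => i.
  by rewrite /= coef1; case: j => [|j] /=; rewrite ?coef1 ?coef0.
rewrite fps2_coefM /= coefM coef_sum.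
by apply: eq_bigr => b _; rewrite coefM.
Qed.

HB.instance Definition _ (R : nzRingType) :=
  GRing.isZmodMorphism.Build {poly {poly R}} {fps {fps R}} (@fps_of_poly2 R)
    (@fps_of_poly2_zmod R).
HB.instance Definition _ (R : nzRingType) :=
  GRing.isMonoidMorphism.Build {poly {poly R}} {fps {fps R}} (@fps_of_poly2 R)
    (@fps_of_poly2_monoid R).

Lemma fps_of_poly2_inj (R : nzRingType) : injective (@fps_of_poly2 R).
Proof.
move=> p q /fpsP pq; apply/polyP => j; apply/polyP => i.
by have /fpsP/(_ i) := pq j.
Qed.

(* A subring of a domain, seen as a domain in its own right. *)
Section Subring.
Variables (R : idomainType) (S : subringClosed R).

Record subring := Subring { subring_val : R; _ : subring_val \in S }.

HB.instance Definition _ := [isSub for subring_val].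
HB.instance Definition _ := [Choice of subring by <:].
HB.instance Definition _ := [SubChoice_isSubComNzRing of subring by <:].
HB.instance Definition _ := GRing.ComNzRing_hasMulInverse.Build subring
  (@cmulVx subring) (@cunitPl subring) (@cinv_out subring).

Fact subring_idomain : GRing.integral_domain_axiom subring.
Proof.
move=> a b ab0; rewrite -!(inj_eq val_inj) rmorph0 -mulf_eq0 -rmorphM ab0.
by rewrite rmorph0.
Qed.

HB.instance Definition _ :=
  GRing.ComUnitRing_isIntegral.Build subring subring_idomain.
End Subring.

(* B[1/b], as the subring of the a / b^n in the fraction field of B; it is meant
   for b != 0 (the inverse of 0 being 0, it is the image of B when b = 0). *)
Section Localization.
Variables (B : idomainType) (b : B).

Definition locp : {pred {fraction B}} :=
  fun u => `[< exists a n, u = a%:F / b%:F ^+ n >].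

Fact locp_subring : subring_closed locp.
Proof.
split.
- by apply/asboolP; exists 1, 0%N; rewrite expr0 divr1 tofrac1.
- move=> _ _ /asboolP[a [n ->]] /asboolP[c [m ->]]; apply/asboolP.
  have [b0|b0] := eqVneq b%:F 0; last first.
    exists (a * b ^+ m - c * b ^+ n), (n + m)%N.
    rewrite tofracB !tofracM !tofracXn exprD mulrBl.
    rewrite -[X in _ = X - _]mulf_div divff ?expf_neq0 // mulr1.
    by rewrite [b%:F ^+ n * _]mulrC -[X in _ = _ - X]mulf_div
      divff ?expf_neq0 // mulr1.
  have e (d : B) k : exists d' : B, d%:F / b%:F ^+ k = d'%:F.
    rewrite b0; case: k => [|k]; first by exists d; rewrite expr0 divr1.
    by exists 0; rewrite expr0n invr0 mulr0 tofrac0.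
  have [[a' ->] [c' ->]] := (e a n, e c m).
  by exists (a' - c'), 0%N; rewrite expr0 divr1 tofracB.
move=> _ _ /asboolP[a [n ->]] /asboolP[c [m ->]]; apply/asboolP.
by exists (a * c), (n + m)%N; rewrite mulf_div tofracM exprD.
Qed.

HB.instance Definition _ :=
  GRing.isSubringClosed.Build {fraction B} locp locp_subring.

Definition loc : idomainType := subring locp.

Fact to_loc_subproof (a : B) : a%:F \in locp.
Proof. by apply/asboolP; exists a, 0%N; rewrite expr0 divr1. Qed.

Definition to_loc (a : B) : loc := Subring (to_loc_subproof a).

Fact to_loc_zmod : zmod_morphism to_loc.
Proof. by move=> u v; apply: val_inj; rewrite rmorphB /= tofracB. Qed.
Fact to_loc_monoid : monoid_morphism to_loc.
Proof.
split=> [|u v]; apply: val_inj; rewrite ?rmorph1 ?rmorphM /=.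
  exact: tofrac1.
exact: tofracM.
Qed.

HB.instance Definition _ := GRing.isZmodMorphism.Build B loc to_loc to_loc_zmod.
HB.instance Definition _ :=
  GRing.isMonoidMorphism.Build B loc to_loc to_loc_monoid.

Lemma to_loc_inj : injective to_loc.
Proof.
by move=> u v /(congr1 val) /= /eqP uv; apply/eqP; rewrite -tofrac_eq.
Qed.
End Localization.

(* The extension R <= S is given by an injective morphism i. *)
Definition TGF (R S : idomainType) (i : {rmorphism R -> S})
    (i_inj : injective i) : Prop :=
  forall P : prime_idealr S,
    (exists2 s : S, s \in P & s != 0) -> exists2 r : R, i r \in P & r != 0.

Section IntermediateRing.
Variables (D : idomainType) (B : subringClosed {fps {fps D}}).
Hypothesis polyB : forall p : {poly {poly D}}, fps_of_poly2 p \in B.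

Definition xB : subring B := Subring (polyB 'X%:P).

Lemma xB_neq0 : xB != 0.
Proof.
apply/eqP => /(congr1 val)/fpsP/(_ 0)/fpsP/(_ 1)/eqP.
by rewrite rmorph0 /= coefC coefX oner_eq0.
Qed.
End IntermediateRing.

(* Main.v *)
Require Import Defs.
From HB Require Import structures.
From mathcomp Require Import all_boot all_order all_algebra.
From mathcomp Require Import boolp.
From mathcomp Require Import zify.

Set Implicit Arguments.
Unset Strict Implicit.
Unset Printing Implicit Defensive.

Import GRing.Theory.
Local Open Scope ring_scope.

(** Why the extension is not TGF.  It suffices to find a ring morphism from
    B_x[[z]] to a domain that kills some nonzero element and is injective on
    B[[z]]: its kernel is then a nonzero prime contracting to 0 (not_TGF).

    The morphism is a substitution.  Let L = D[[x]][1/x] and let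
    sigma = sum_(i >= 1) x^(-gap i) z^i in L[[z]], with gap i = (i!)^2.  An
    element of B_x is a power series in y over L (loc_universal), and as sigma
    has no constant term, y |-> sigma defines a morphism from B_x[[z]] to
    L[[z]].  The coefficients of sigma lie in the subring generated by 1/x, so
    y - sigma is in B_x[[z]]; it is nonzero and is sent to 0.

    Injectivity on B[[z]] (ev_sigma_inj) is where the fast growth of gap enters.
    Let F in D[[x]][[z]][[y]] be nonzero with F(sigma) = 0.  Write
    F = (y - sigma)^k q with q(sigma) != 0, so that k > 0, and substitute for y
    the truncation tau of sigma to degrees <= n in z.  Let M be the z-order of
    q(sigma).  For n large, q(tau) and q(sigma) have the same leading term, so
    F(tau) = (tau - sigma)^k q(tau) has order K = k (n + 1) + M, and its leading
    coefficient has a pole in x of order k * gap n.+1 up to a constant.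
    On the other hand, F has no poles, and every z in tau costs at most
    x^(-gap n), so this pole has order at most K * gap n.  As gap n.+1 is
    (n + 1)^2 gap n, this is impossible for large n (gap_gain).  Passing
    to a power of y - sigma instead of differentiating F makes the argument
    valid in every characteristic.

    The substitution is built without infinite sums, by dividing by y - s:
    every g in L[[z]][[y]] is uniquely (y - s) q + r with r in L[[z]], and
    g |-> r is a ring morphism because of uniqueness. *)

(** * Orders and linear factors of power series *)

Section Vanish.
Variable R : comNzRingType.
Implicit Types f g : {fps R}.

Definition vanish m f := forall i, (i < m)%N -> f`[i] = 0.

Lemma vanishM m k f g : vanish m f -> vanish k g ->
  vanish (m + k) (f * g) /\ (f * g)`[m + k] = f`[m] * g`[k].
Proof.
move=> fm gk; split=> [n nmk|].
  rewrite fps_coefM big1 // => i _; have [im|mi] := ltnP i m.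
    by rewrite fm ?mul0r.
  by rewrite gk ?mulr0 //; have := ltn_ord i; lia.
have mmk : (m < (m + k).+1)%N by rewrite ltnS leq_addr.
rewrite fps_coefM (bigD1 (Ordinal mmk)) //= addKn big1 ?addr0 // => i.
rewrite -val_eqE /= => im; case: (ltngtP i m) im => // im _.
  by rewrite fm ?mul0r.
by rewrite gk ?mulr0 //; have := ltn_ord i; lia.
Qed.

Lemma vanishX m f k : vanish m f ->
  vanish (k * m) (f ^+ k) /\ (f ^+ k)`[k * m] = f`[m] ^+ k.
Proof.
move=> fm; elim: k => [|k [IHv IHc]]; first by rewrite !expr0; split.
by have [v c] := vanishM fm IHv; rewrite mulSn !exprS -IHc.
Qed.

Lemma vanishMr m f g : vanish m g -> vanish m (f * g).
Proof. by move=> gm; have [] := @vanishM 0 m f g _ gm. Qed.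

Definition fpsC (c : R) : {fps R} := Fps (fun n => if n is 0 then c else 0).

Lemma fpsC_coefM c f n : (fpsC c * f)`[n] = c * f`[n].
Proof.
by rewrite fps_coefM big_ord_recl /= subn0 big1 ?addr0 // => i; rewrite mul0r.
Qed.

Fact fpsC_zmod : zmod_morphism fpsC.
Proof. by move=> a b; apply/fpsP => -[|n] //=; rewrite subr0. Qed.
Fact fpsC_monoid : monoid_morphism fpsC.
Proof.
split=> [|a b]; apply/fpsP => -[|n] //; rewrite fpsC_coefM //=.
by rewrite mulr0.
Qed.

HB.instance Definition _ := GRing.isZmodMorphism.Build R {fps R} fpsC fpsC_zmod.
HB.instance Definition _ :=
  GRing.isMonoidMorphism.Build R {fps R} fpsC fpsC_monoid.

Definition fps_lin (c : R) : {fps R} :=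
  Fps (fun n => if n is n'.+1 then (n' == 0)%:R else - c).

(** Multiplication by Y - c, the series fps_lin c, in coefficients: this makes
    divisibility by Y - c a recurrence on coefficients. *)
Lemma fps_linM0 c f : (fps_lin c * f)`[0] = - (c * f`[0]).
Proof. by rewrite fps_coefM big_ord_recl big_ord0 addr0 /= mulNr. Qed.

Lemma fps_linMS c f n : (fps_lin c * f)`[n.+1] = f`[n] - c * f`[n.+1].
Proof.
rewrite fps_coefM 2!big_ord_recl big1 ?addr0 /=; last first.
  by move=> i _; rewrite mul0r.
by rewrite mul1r mulNr addrC subn0 /bump /= subn1.
Qed.

Lemma fps_linB c d : fps_lin c = fps_lin d + fpsC (d - c).
Proof.
apply/fpsP => -[|n]; rewrite fps_coefD /=; last by rewrite addr0.
by rewrite addrA addNr add0r.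
Qed.
End Vanish.

(** * Substitution of a series without constant term *)

Section Evaluation.
Variables (R : idomainType) (s : {fps R}).
Hypothesis s0 : s`[0] = 0.
Implicit Types g q : {fps {fps R}}.

(** The sum of the g_(j+i) s^i over all i.  In degree n only the terms with
    i <= n contribute, since s^i has order at least i. *)
Definition fps_tail g j : {fps R} :=
  Fps (fun n => (\sum_(i < n.+1) g`[j + i] * s ^+ i)`[n]).

Definition ev g := fps_tail g 0.
Definition quo g : {fps {fps R}} := Fps (fun j => fps_tail g j.+1).

Lemma vanish_sX k : vanish k (s ^+ k).
Proof.
have s1 : vanish 1 s by case.
by have [] := vanishX k s1; rewrite muln1.
Qed.

Lemma fps_tail_coef g j n K : (n < K)%N ->
  (fps_tail g j)`[n] = (\sum_(i < K) g`[j + i] * s ^+ i)`[n].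
Proof.
move=> nK; rewrite -(subnKC nK) big_split_ord fps_coefD /=.
rewrite [X in _ = _ + X]fps_coef_sum [X in _ = _ + X]big1 ?addr0 // => i _ /=.
by apply: (vanishMr (m := n.+1 + i)); rewrite ?leq_addr //; apply: vanish_sX.
Qed.

Lemma fps_tail_rec g j : fps_tail g j = g`[j] + s * fps_tail g j.+1.
Proof.
apply/fpsP => n.
have -> : (g`[j] + s * fps_tail g j.+1)`[n] =
    (g`[j] + s * \sum_(i < n.+1) g`[j.+1 + i] * s ^+ i)`[n].
  rewrite !fps_coefD !fps_coefM; congr (_ + _); apply: eq_bigr => a _.
  by rewrite -fps_tail_coef // ltnS leq_subr.
rewrite (@fps_tail_coef _ _ _ n.+2) // big_ord_recl addn0 expr0 mulr1.
congr (_ + _)`[n]; rewrite mulr_sumr; apply: eq_bigr => i _.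
by rewrite exprS /bump /= addnS mulrCA.
Qed.

Lemma fps_div g : g = fps_lin s * quo g + fpsC (ev g).
Proof.
apply/fpsP => -[|j]; rewrite fps_coefD ?fps_linM0 ?fps_linMS /=.
  by rewrite /ev [fps_tail g 0]fps_tail_rec addrCA addNr addr0.
by rewrite addr0 [fps_tail g j.+1]fps_tail_rec addrK.
Qed.

(** If (Y - s) q is constant, the recurrence on coefficients gives
    q_0 = s^k q_k for every k, so q_0 has infinite order and vanishes. *)
Lemma fps_lin_const q r : fps_lin s * q = fpsC r -> r = 0.
Proof.
move=> /fpsP qr; have qs j : q`[j] = s * q`[j.+1].
  by have /eqP := qr j.+1; rewrite fps_linMS subr_eq0 => /eqP.
have q0 k : q`[0] = s ^+ k * q`[k].
  by elim: k => [|k IH]; rewrite ?mul1r // IH qs exprSr mulrA.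
have := qr 0; rewrite fps_linM0 /= => <-; suff -> : q`[0] = 0.
  by rewrite mulr0 oppr0.
apply/fpsP => n; rewrite (q0 n.+1) mulrC.
by rewrite (vanishMr _ (@vanish_sX n.+1)).
Qed.

Lemma ev_unique g q r : g = fps_lin s * q + fpsC r -> ev g = r.
Proof.
rewrite {1}[g]fps_div => /eqP; rewrite -subr_eq0 opprD addrACA -mulrBr -rmorphB.
rewrite addr_eq0 -rmorphN => /eqP /fps_lin_const /eqP.
by rewrite oppr_eq0 subr_eq0 => /eqP.
Qed.

Lemma ev_linM q : ev (fps_lin s * q) = 0.
Proof. by apply: (@ev_unique _ q); rewrite rmorph0 addr0. Qed.

Lemma evC r : ev (fpsC r) = r.
Proof. by apply: (@ev_unique _ 0); rewrite mulr0 add0r. Qed.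

Fact ev_zmod : zmod_morphism ev.
Proof.
move=> g h; apply: (@ev_unique _ (quo g - quo h)).
by rewrite {1}[g]fps_div {1}[h]fps_div rmorphB mulrBr opprD addrACA.
Qed.

Fact ev_monoid : monoid_morphism ev.
Proof.
split=> [|g h]; first by rewrite -(evC 1) rmorph1.
apply: (@ev_unique _ (quo g * h + fpsC (ev g) * quo h)).
rewrite {1}[g]fps_div mulrDl {2}[h]fps_div mulrDr rmorphM mulrDr addrA.
by rewrite -[fps_lin s * quo g * h]mulrA [fpsC _ * (_ * _)]mulrCA.
Qed.

Lemma ev_lin c : ev (fps_lin c) = s - c.
Proof. by apply: (@ev_unique _ 1); rewrite mulr1 -fps_linB. Qed.

(** The substitution Y |-> s. *)
Definition ev_morph : {rmorphism {fps {fps R}} -> {fps R}} :=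
  HB.pack ev (GRing.isZmodMorphism.Build _ _ ev ev_zmod)
    (GRing.isMonoidMorphism.Build _ _ ev ev_monoid).

(** Y - s has no term of total degree 0, so its k-th power has none of total
    degree less than k; this bounds the multiplicity of Y - s in a series. *)
Lemma fps_lin_sX_small k q j n : (j + n < k)%N ->
  (fps_lin s ^+ k * q)`[j]`[n] = 0.
Proof.
elim: k j n => // k IH j n jnk; rewrite exprS -mulrA.
have sq i : ((s * (fps_lin s ^+ k * q)`[i])`[n] = 0) \/ (k < i + n)%N.
  have [?|ink] := ltnP k (i + n); [by right | left].
  rewrite fps_coefM big_ord_recl s0 mul0r add0r big1 // => a _.
  by rewrite IH ?mulr0 //= /bump /=; have := ltn_ord a; lia.
case: j jnk => [|j] jnk; rewrite ?fps_linM0 ?fps_linMS.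
  by rewrite fps_coefN; case: (sq 0) => [->|]; rewrite ?oppr0 //; lia.
rewrite fps_coefD fps_coefN IH ?add0r; last lia.
by case: (sq j.+1) => [->|]; rewrite ?oppr0 //; lia.
Qed.

Lemma fps_lin_factor g : g != 0 ->
  exists k q, g = fps_lin s ^+ k * q /\ ev q != 0.
Proof.
move=> g0; have [j [n gjn]] : exists j n, g`[j]`[n] != 0.
  apply: contrapT => nex; case/eqP: g0; apply/fpsP => j; apply/fpsP => n.
  by apply/eqP; apply/negPn/negP => gjn; apply: nex; exists j, n.
pose P k := `[< exists q, g = fps_lin s ^+ k * q >].
have P0 : exists k, P k by exists 0%N; apply/asboolP; exists g; rewrite mul1r.
have Pb k : P k -> (k <= j + n)%N.
  move=> /asboolP[q gE]; rewrite leqNgt; apply: contra gjn => jnk.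
  by rewrite gE fps_lin_sX_small.
case: (ex_maxnP P0 Pb) => k /asboolP[q gE] kmax; exists k, q; split=> //.
apply/eqP => q0; suff /kmax : P k.+1 by rewrite ltnn.
apply/asboolP; exists (quo q).
by rewrite exprSr -mulrA {1}gE {1}[q]fps_div q0 rmorph0 addr0.
Qed.
End Evaluation.

(** Division by Y - t gives g(s) - g(t) = (s - t) q(s). *)
Lemma ev_close (R : idomainType) (s t : {fps R}) (s0 : s`[0] = 0)
  (t0 : t`[0] = 0) N g : vanish N (s - t) -> vanish N (ev s g - ev t g).
Proof.
move=> st; have -> : ev s g = ev_morph s0 (fps_lin t * quo t g + fpsC (ev t g)).
  by rewrite -fps_div.
rewrite rmorphD rmorphM /= evC // addrK ev_lin // mulrC.
exact: vanishMr.
Qed.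

(** * Exchanging the two indeterminates *)

Section Swap.
Variable R : nzRingType.

Definition fps_swap (f : {fps {fps R}}) : {fps {fps R}} :=
  Fps (fun j => Fps (fun i => f`[i]`[j])).

Fact fps_swap_zmod : zmod_morphism fps_swap.
Proof. by move=> f g; apply/fpsP => j; apply/fpsP => i. Qed.
Fact fps_swap_monoid : monoid_morphism fps_swap.
Proof.
split=> [|f g]; apply/fpsP => j; apply/fpsP => i.
  by case: i => [|i]; case: j.
by rewrite fps2_coefM /= fps2_coefM exchange_big.
Qed.

HB.instance Definition _ := GRing.isZmodMorphism.Build
  {fps {fps R}} {fps {fps R}} fps_swap fps_swap_zmod.
HB.instance Definition _ := GRing.isMonoidMorphism.Build
  {fps {fps R}} {fps {fps R}} fps_swap fps_swap_monoid.
End Swap.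

(** * The universal property of a localization *)

Section LocLift.
Variables (B : idomainType) (b : B) (b0 : b != 0).
Variables (A : comUnitRingType) (h : {rmorphism B -> A}).
Hypothesis hb : h b \is a GRing.unit.

Lemma loc_repr (u : loc b) : exists an : B * nat,
  to_loc b b ^+ an.2 * u = to_loc b an.1.
Proof.
case: u => u up; case/asboolP: (up) => a [n uE]; exists (a, n).
apply: val_inj; rewrite rmorphM rmorphXn /= uE mulrC divfK //.
by rewrite expf_neq0 // tofrac_eq0.
Qed.

(** Defined from an arbitrary choice of a and n with b^n u = a; loc_liftE shows
    that the choice does not matter. *)
Definition loc_lift (u : loc b) : A :=
  let an := projT1 (cid (loc_repr u)) in h an.1 / h b ^+ an.2.

Lemma loc_liftE (u : loc b) (a : B) n : to_loc b b ^+ n * u = to_loc b a ->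
  h b ^+ n * loc_lift u = h a.
Proof.
rewrite /loc_lift; case: cid => -[c m] /= uc ua.
have /(congr1 h) : b ^+ n * c = b ^+ m * a.
  apply: (@to_loc_inj _ b); rewrite !rmorphM !rmorphXn /= -uc.
  by rewrite -ua mulrCA.
rewrite !rmorphM !rmorphXn mulrA => ->; rewrite mulrAC divrr ?mul1r //.
exact: unitrX.
Qed.

Fact loc_lift_zmod : zmod_morphism loc_lift.
Proof.
move=> u v; have [[[a n] /= ua] [[c m] /= vc]] := (loc_repr u, loc_repr v).
apply: (@mulrI _ (h b ^+ (n + m))); first exact: unitrX.
have /loc_liftE -> : to_loc b b ^+ (n + m) * (u - v) =
    to_loc b (b ^+ m * a - b ^+ n * c).
  rewrite rmorphB !rmorphM !rmorphXn /= -ua -vc exprD mulrBr !mulrA.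
  by rewrite [_ ^+ m * _ ^+ n]mulrC.
rewrite rmorphB !rmorphM !rmorphXn mulrBr exprD -(loc_liftE ua) -(loc_liftE vc).
by rewrite !mulrA [_ ^+ m * _ ^+ n]mulrC.
Qed.

Fact loc_lift_monoid : monoid_morphism loc_lift.
Proof.
split=> [|u v].
  by rewrite -[LHS]mul1r -(expr0 (h b)) (@loc_liftE _ 1) ?rmorph1 ?mulr1.
have [[[a n] /= ua] [[c m] /= vc]] := (loc_repr u, loc_repr v).
apply: (@mulrI _ (h b ^+ (n + m))); first exact: unitrX.
have /loc_liftE -> : to_loc b b ^+ (n + m) * (u * v) = to_loc b (a * c).
  by rewrite rmorphM /= -ua -vc exprD mulrACA.
by rewrite exprD mulrACA !(loc_liftE ua, loc_liftE vc) rmorphM.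
Qed.

Lemma loc_lift_to_loc a : loc_lift (to_loc b a) = h a.
Proof. by rewrite -[LHS]mul1r -(expr0 (h b)) (@loc_liftE _ a) ?mul1r. Qed.

Lemma loc_universal :
  exists g : {rmorphism loc b -> A}, forall a, g (to_loc b a) = h a.
Proof.
pose zm := GRing.isZmodMorphism.Build _ _ _ loc_lift_zmod.
pose mm := GRing.isMonoidMorphism.Build _ _ _ loc_lift_monoid.
pose g : {rmorphism loc b -> A} := HB.pack loc_lift zm mm.
by exists g => a; apply: loc_lift_to_loc.
Qed.
End LocLift.

Lemma to_loc_unit (B : idomainType) (b : B) :
  b != 0 -> to_loc b b \is a GRing.unit.
Proof.
move=> b0; have ip : (tofrac b)^-1 \in locp b.
  by apply/asboolP; exists 1, 1%N; rewrite tofrac1 div1r expr1.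
suff vb : Subring ip * to_loc b b = 1 :> loc b.
  by apply/unitrP; exists (Subring ip); split; rewrite // mulrC.
by apply: val_inj; rewrite rmorphM rmorph1 /= mulVf // tofrac_eq0.
Qed.

(** * A series with rapidly growing poles *)

Section Pole.
Variables (B : idomainType) (b : B).
Local Notation h := (to_loc b).
Local Notation X := (to_loc b b).

Definition integral (u : loc b) := exists a, u = h a.

Lemma integral_sum I (r : seq I) (F : I -> loc b) :
  (forall i, integral (F i)) -> integral (\sum_(i <- r) F i).
Proof.
move=> Fi; apply: (big_ind integral) => [|_ _ [a ->] [c ->]|//].
  by exists 0; rewrite rmorph0.
by exists (a + c); rewrite rmorphD.
Qed.

(** The series in z whose coefficients become integral under z |-> b^c z; they
    form a subring, which is the reason for a bound linear in the degree. *)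
Definition polar c (f : {fps loc b}) := forall n, integral (X ^+ (c * n) * f`[n]).

Lemma polar_integral c (f : {fps loc b}) :
  (forall n, integral f`[n]) -> polar c f.
Proof.
by move=> fi n; have [a ->] := fi n; exists (b ^+ (c * n) * a);
  rewrite rmorphM rmorphXn.
Qed.

Lemma polar_sum c I (r : seq I) (F : I -> {fps loc b}) :
  (forall i, polar c (F i)) -> polar c (\sum_(i <- r) F i).
Proof.
move=> Fp n; rewrite fps_coef_sum mulr_sumr; apply: integral_sum => i.
exact: Fp.
Qed.

Lemma polarM c (f g : {fps loc b}) : polar c f -> polar c g -> polar c (f * g).
Proof.
move=> fp gp n; rewrite fps_coefM mulr_sumr; apply: integral_sum => i.
have [[u uE] [v vE]] := (fp i, gp (n - i)%N); exists (u * v).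
have {1}-> : n = (i + (n - i))%N by rewrite subnKC // -ltnS.
by rewrite mulnDr exprD mulrACA uE vE rmorphM.
Qed.

Lemma polarX c (f : {fps loc b}) k : polar c f -> polar c (f ^+ k).
Proof.
move=> fp; elim: k => [|k IH]; last by rewrite exprS; apply: polarM.
rewrite expr0; apply: polar_integral => n; rewrite fps_coef1.
by exists (n == 0)%:R; rewrite rmorph_nat.
Qed.

Lemma polar_ev c (s : {fps loc b}) (F : {fps {fps loc b}}) : polar c s ->
  (forall j n, integral F`[j]`[n]) -> polar c (ev s F).
Proof.
move=> sp Fi n; rewrite /ev /=; apply: polar_sum => i.
by apply: polarM; [apply: polar_integral => m; apply: Fi | apply: polarX].
Qed.

(** What matters is that gap n.+1 / gap n eventually exceeds every linear
    function of n. *)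
Definition gap i := (i`! ^ 2)%N.

Lemma gap_gt0 i : (0 < gap i)%N. Proof. by rewrite expn_gt0 fact_gt0. Qed.

Lemma gapS i : gap i.+1 = (i.+1 * i.+1 * gap i)%N.
Proof. by rewrite /gap factS expnMn. Qed.

Lemma leq_gap i j : (i <= j)%N -> (gap i <= gap j)%N.
Proof. by move=> ij; rewrite leq_exp2r // leq_fact. Qed.

Definition sigma : {fps loc b} :=
  Fps (fun i => if i is 0 then 0 else X ^- gap i).

Definition sigma_trunc n : {fps loc b} :=
  Fps (fun i => if (i <= n)%N then sigma`[i] else 0).

Lemma vanish_sigma_trunc n : vanish n.+1 (sigma_trunc n - sigma).
Proof. by move=> i; rewrite ltnS fps_coefD fps_coefN /= => ->; rewrite subrr. Qed.

Lemma sigma_trunc_gap n :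
  (sigma_trunc n - sigma)`[n.+1] = - X ^- gap n.+1.
Proof. by rewrite fps_coefD fps_coefN /= ltnn add0r. Qed.

Hypothesis b0 : b != 0.

(** The pole of order gap i at z^i is at most gap n <= gap n * i as long as
    1 <= i <= n. *)
Lemma polar_sigma_trunc n : polar (gap n) (sigma_trunc n).
Proof.
move=> i /=; have int0 : integral 0 by exists 0; rewrite rmorph0.
case: ifP => [|_]; last by rewrite mulr0.
case: i => [|i] le_in; first by rewrite mulr0.
have le_gap : (gap i.+1 <= gap n * i.+1)%N.
  by rewrite (leq_trans (leq_gap le_in)) // leq_pmulr.
exists (b ^+ (gap n * i.+1 - gap i.+1)).
rewrite -{1}(subnK le_gap) exprD mulrK ?rmorphXn //.
by apply: unitrX; apply: to_loc_unit.
Qed.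
End Pole.

(** With t = 0, this says that the pole k * gap n.+1 exceeds the bound gap n * K
    for the coefficient of degree K = k * n.+1 + M; the margin t absorbs the order
    in x of a fixed leading coefficient. *)
Lemma gap_gain k M t n : (0 < k)%N -> n = (M + t).+1 ->
  (gap n * (k * n.+1 + M) + t < k * gap n.+1)%N.
Proof.
move=> k0 nE; rewrite gapS; have := gap_gt0 n; move: (gap n) => c c0.
have : (c * (M + t).+1 <= k * (n.+1 * n * c))%N by rewrite nE; nia.
by nia.
Qed.

(** * Analytic independence of sigma *)

Section SigmaIndependent.
Variable D : idomainType.

Definition fpsX : {fps D} := Fps (fun i => (i == 1)%:R).

Lemma fpsX_neq0 : fpsX != 0.
Proof. by apply/eqP => /fpsP/(_ 1)/eqP; rewrite oner_eq0. Qed.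

Local Notation h := (to_loc fpsX).

(** Compares, at the leading coefficient of F(tau), the pole produced by
    (tau - sigma)^k with the bound that holds as F has no poles. *)
Lemma ev_sigma_inj (F : {fps {fps loc fpsX}}) :
  (forall j n, integral F`[j]`[n]) -> ev (sigma fpsX) F = 0 -> F = 0.
Proof.
move=> Fi F0; apply/eqP; apply/negPn/negP.
case/(fps_lin_factor (s := sigma fpsX) erefl) => k [q [FE q0]].
have k0 : (0 < k)%N.
  by case: k FE => // FE; case/eqP: q0; rewrite -F0 FE mul1r.
have [M lM qM] := fps_order q0.
(* The leading coefficient l of q(sigma) is a / x^p. *)
set l := (ev (sigma fpsX) q)`[M] in lM.
have [[a p] /= lE] := loc_repr fpsX_neq0 l.
have X0 m : h fpsX ^+ m != 0.
  by rewrite -rmorphXn -(rmorph0 h) (inj_eq (@to_loc_inj _ _)) expf_neq0 ?fpsX_neq0.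
have a0 : a != 0.
  by apply: contra_neq (mulf_neq0 (X0 p) lM) => a0; rewrite lE a0 rmorph0.
have [t at0 _] := fps_order a0.
pose n := (M + t).+1; pose tau := sigma_trunc fpsX n.
have tau0 : tau`[0] = 0 by [].
have tq := ev_close tau0 (erefl : (sigma fpsX)`[0] = 0) q
  (@vanish_sigma_trunc _ fpsX n).
(* q(tau) and q(sigma) agree up to degree n, hence have the same leading term. *)
have tauq i : (i <= M)%N -> (ev tau q)`[i] = (ev (sigma fpsX) q)`[i].
  move=> iM; apply/eqP; rewrite -subr_eq0 -fps_coefN -fps_coefD tq //.
  by rewrite /n; lia.
have tauM : vanish M (ev tau q) by move=> i iM; rewrite tauq ?qM // ltnW.
have [vk ck] := vanishX k (@vanish_sigma_trunc _ fpsX n).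
have [_] := vanishM vk tauM; rewrite ck tauq // -/l.
have <- : ev tau F = (tau - sigma fpsX) ^+ k * ev tau q.
  rewrite FE -(ev_lin tau0).
  by rewrite -[ev tau _]/(ev_morph tau0 _) rmorphM rmorphXn.
rewrite sigma_trunc_gap => evF.
have [u] := @polar_ev _ _ _ tau _ (@polar_sigma_trunc _ _ fpsX_neq0 n) Fi
  (k * n.+1 + M)%N.
rewrite evF => uE.
have [e te eE] : exists2 e, (t < e)%N &
    (k * gap n.+1 + p = gap n * (k * n.+1 + M) + e)%N.
  exists (k * gap n.+1 + p - gap n * (k * n.+1 + M))%N;
    have := gap_gain k0 (erefl n); lia.
have key : h fpsX ^+ (k * gap n.+1) * (- h fpsX ^- gap n.+1) ^+ k = (-1) ^+ k.
  rewrite mulnC exprM -exprMn mulrN divrr //.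
  by apply/unitrX/to_loc_unit/fpsX_neq0.
(* Clearing denominators in the leading coefficient of F(tau) makes the fixed
   series a, up to sign, divisible by a power of x beyond its order t. *)
have auE : (-1) ^+ k * a = fpsX ^+ e * u.
  apply: (mulfI (expf_neq0 (gap n * (k * n.+1 + M)) fpsX_neq0)).
  rewrite [RHS]mulrA -exprD -eE; apply: (@to_loc_inj _ fpsX).
  rewrite !rmorphM !rmorphXn rmorphN rmorph1 /= -uE -lE exprD -key.
  by rewrite [_ * _ * (_ * l)]mulrACA [LHS]mulrCA.
have : (fpsX ^+ e * u)`[t] = 0.
  have f1 : vanish 1 fpsX by move=> [].
  have [fe _] := vanishX e f1; rewrite muln1 in fe.
  by rewrite mulrC; apply: (vanishMr u fe).
rewrite -auE -signr_odd; case: odd; rewrite ?mulN1r ?mul1r ?fps_coefN => /eqP.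
  by rewrite oppr_eq0 (negPf at0).
by rewrite (negPf at0).
Qed.
End SigmaIndependent.

(** * The kernel of the substitution *)

(** The kernel of phi is the required prime; it is prime as A is a domain. *)
Lemma not_TGF (R S A : idomainType) (i : {rmorphism R -> S})
    (i_inj : injective i) (phi : {rmorphism S -> A}) (a : S) :
  a != 0 -> phi a = 0 -> (forall r, phi (i r) = 0 -> r = 0) -> ~ TGF i_inj.
Proof.
move=> a0 pa phi_inj; pose P : {pred S} := fun u => phi u == 0.
have inP u : (u \in P) = (phi u == 0) by [].
have P_ideal : idealr_closed P.
  split=> [||c u v /eqP u0 /eqP v0]; rewrite inP ?rmorph0 ?rmorph1 ?oner_eq0 //.
  by rewrite rmorphD rmorphM u0 v0 mulr0 addr0.
have P_prime : prime_idealr_closed P.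
  by move=> u v; rewrite !inP rmorphM mulf_eq0.
pose K : prime_idealr S := HB.pack P (isIdealr.Build _ _ P_ideal)
  (isPrimeIdealrClosed.Build _ _ P_prime).
case/(_ K); first by exists a; rewrite // inP pa.
by move=> r /eqP /phi_inj ->; rewrite eqxx.
Qed.

Theorem corollary4 (D : idomainType) (B : subringClosed {fps {fps D}})
    (polyB : forall p : {poly {poly D}}, fps_of_poly2 p \in B) :
  ~ @TGF {fps (subring B)} {fps (loc (xB polyB))}
      (fps_map (to_loc (xB polyB)))
      (fps_map_inj (to_loc_inj (b := xB polyB))).
Proof.
pose x := xB polyB; pose X := to_loc (fpsX D) (fpsX D).
pose hB : {rmorphism subring B -> {fps loc (fpsX D)}} :=
  fps_map (to_loc (fpsX D)) \o val.
have hBE b j : (hB b)`[j] = to_loc (fpsX D) (val b)`[j] by [].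
have hx : hB x = fpsC X.
  apply/fpsP => -[|j]; rewrite hBE /=.
    by congr (to_loc _ _); apply/fpsP => i; rewrite /= coefC coefX.
  rewrite -(rmorph0 (to_loc (fpsX D))); congr (to_loc _ _); apply/fpsP => i.
  by rewrite /= coefC coef0.
have XU : X \is a GRing.unit by apply/to_loc_unit/fpsX_neq0.
have hxU : hB x \is a GRing.unit by rewrite hx rmorph_unit.
have [psi psiE] := loc_universal (xB_neq0 polyB) hxU.
pose s := sigma (fpsX D); have s0 : s`[0] = 0 by [].
(* The swap is needed as z is the outer indeterminate of B_x[[z]], while the
   substitution is for the outer one. *)
pose phi : {rmorphism {fps loc x} -> {fps loc (fpsX D)}} :=
  ev_morph s0 \o (@fps_swap _ \o fps_map psi).
(* The element y - sigma of B_x[[z]]. *)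
pose w : {fps loc x} := Fps (fun n =>
  if n is 0 then to_loc x (Subring (polyB 'X)) else - to_loc x x ^- gap n).
have wE : fps_swap (fps_map psi w) = fps_lin s.
  apply/fpsP => j; apply/fpsP => -[|n].
    rewrite /= psiE hBE; case: j => [|[|j]] /=.
    - rewrite oppr0 -(rmorph0 (to_loc (fpsX D))); congr (to_loc _ _).
      by apply/fpsP => i; rewrite /= coefX coef0.
    - rewrite -[RHS](rmorph1 (to_loc (fpsX D))); congr (to_loc _ _).
      by apply/fpsP => i; rewrite /= coefX coef1; case: i.
    rewrite -[RHS](rmorph0 (to_loc (fpsX D))); congr (to_loc _ _).
    by apply/fpsP => i; rewrite /= coefX coef0.
  have -> : (fps_swap (fps_map psi w))`[j]`[n.+1] = (fpsC (- X ^- gap n.+1))`[j].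
    rewrite /= rmorphN rmorphV ?unitrX ?to_loc_unit ?xB_neq0 // rmorphXn psiE.
    by rewrite hx -rmorphXn -rmorphV ?unitrX // -rmorphN.
  by case: j => [|[|j]].
apply: (not_TGF (phi := phi) (a := w)).
- apply/eqP => w0; have := wE; rewrite w0 !rmorph0 => /fpsP/(_ 1)/eqP.
  by rewrite eq_sym oner_eq0.
- by rewrite /= wE ev_lin // subrr.
move=> r phir; have rE j n :
    (fps_swap (fps_map psi (fps_map (to_loc x) r)))`[j]`[n] =
    to_loc (fpsX D) (val r`[n])`[j] by rewrite /= psiE.
have r0 : fps_swap (fps_map psi (fps_map (to_loc x) r)) = 0.
  apply: ev_sigma_inj phir => j n.
  by exists (val r`[n])`[j]; apply: rE.
apply/fpsP => n; apply: val_inj; apply/fpsP => j.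
by apply: (@to_loc_inj _ (fpsX D)); rewrite -rE r0 rmorph0.
Qed.
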